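(* Let $p\in(1,2)$, $\sigma>0$, let $R\ge1$ be an integer, fix $\gamma\in(0,\frac12)$ and $\theta\in(0,1)$, and let $M$ be a positive integer with $M>\frac{2}{p\theta\gamma}$. Let $\boldsymbol{\nu}_1,\dots,\boldsymbol{\nu}_M$ be the chunk gradient noises (defined in the context) built from per-point noises satisfying the gradient noise assumption in the context with constants $\sigma,p$, and let $\boldsymbol{\nu}_{j^\star}$ be their medoid. Then $$\mathbb{E}\left[\|\boldsymbol{\nu}_{j^\star}\|^2\right]\le\left(\frac{\sigma\left((3-2\gamma)M+3\right)}{R^{\frac{p-1}{p}}\,(1-2\gamma)M\,\left((1-\gamma)^{1-\gamma}\gamma^{\gamma}\right)^{\frac{1}{(1-\theta)p\gamma}}}\right)^{2}\left(1+\frac{2}{p\theta\gamma M-2}\right).$$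
   Context: $\|\cdot\|$ is the Euclidean norm on $\mathbb{R}^d$. Everything is at a fixed point $\mathbf{x}$ and a fixed iteration, so dependence on these is dropped. Gradient noise assumption: the per-point noises $\boldsymbol{\nu}_{\boldsymbol{\xi}_1},\dots,\boldsymbol{\nu}_{\boldsymbol{\xi}_K}$, $K=MR$, are mutually independent, identically distributed $\mathbb{R}^d$-valued random vectors, absolutely continuous with respect to Lebesgue measure, symmetric (i.e. $\boldsymbol{\nu}_{\boldsymbol{\xi}_i}$ and $-\boldsymbol{\nu}_{\boldsymbol{\xi}_i}$ have the same distribution), and $\mathbb{E}[\|\boldsymbol{\nu}_{\boldsymbol{\xi}_i}\|^p]\le\sigma^p$. Chunk gradient noises: the $K$ points are split into $M$ disjoint chunks of $R$ points each; with $\boldsymbol{\xi}_{j_1},\dots,\boldsymbol{\xi}_{j_R}$ the points of chunk $j$, $\boldsymbol{\nu}_j=\frac1R\sum_{k=1}^R\boldsymbol{\nu}_{\boldsymbol{\xi}_{j_k}}$, $j=1,\dots,M$. Medoid: $\boldsymbol{\nu}_{j^\star}$ with $j^\star\in\arg\min_{1\le j\le M}\sum_{i=1}^M\|\boldsymbol{\nu}_i-\boldsymbol{\nu}_j\|$ (ties, if any, broken by the smallest index). *)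

(* Defs.v *)
From HB Require Import structures.
From mathcomp Require Import all_boot all_order all_algebra.
From mathcomp Require Import all_classical all_reals all_analysis.

Set Implicit Arguments.
Unset Strict Implicit.
Unset Printing Implicit Defensive.

Import Order.TTheory GRing.Theory Num.Theory.
Import numFieldNormedType.Exports.

Local Open Scope classical_set_scope.
Local Open Scope ring_scope.

(* The norm that the library puts on ['rV[R]_d] is the sup norm. *)
Definition enorm (R : realType) (d : nat) (v : 'rV[R]_d) : R :=
  Num.sqrt (\sum_(i < d) v ord0 i ^+ 2).

Section measurable_rV.
Context {R : realType} {d : nat}.

Let coors : 'I_d -> 'rV[R]_d -> R := fun i v => v ord0 i.

Let rV_set0 : g_sigma_preimage coors set0.
Proof. exact: sigma_algebra0. Qed.

Let rV_setC A : g_sigma_preimage coors A -> g_sigma_preimage coors (~` A).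
Proof. exact: sigma_algebraC. Qed.

Let rV_bigcup (F : (set 'rV[R]_d)^nat) :
  (forall i, g_sigma_preimage coors (F i)) ->
  g_sigma_preimage coors (\bigcup_i (F i)).
Proof. exact: sigma_algebra_bigcup. Qed.

(* The Borel sigma-algebra of R^d, generated by the coordinates exactly as the
   library does for tuples. *)
HB.instance Definition _ :=
  @isMeasurable.Build (measure_tuple_display default_measure_display)
    'rV[R]_d (g_sigma_preimage coors) rV_set0 rV_setC rV_bigcup.

Lemma measurable_coord (i : 'I_d) :
  measurable_fun [set: 'rV[R]_d] (fun v : 'rV[R]_d => v ord0 i).
Proof.
move=> _ Y mY; rewrite setTI; apply: sub_sigma_algebra => /=.
rewrite -bigcup_seq/=; exists i => /=; first by rewrite mem_index_enum.
by exists Y => //; rewrite setTI.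
Qed.

Lemma measurable_fun_rV disp (T : measurableType disp) (f : T -> 'rV[R]_d) :
  (forall i, measurable_fun [set: T] (fun x => f x ord0 i)) ->
  measurable_fun [set: T] f.
Proof.
move=> mf _ A mA; rewrite setTI.
have {mA} : g_sigma_preimage coors A by [].
have : g_sigma_preimage coors `<=` [set A | measurable (f @^-1` A)].
  apply: smallest_sub.
    split => /= [|B mB|F mF]; first by rewrite preimage_set0.
      by rewrite setTD preimage_setC; exact: measurableC.
    by rewrite preimage_bigcup; exact: bigcupT_measurable.
  rewrite -bigcup_seq => B [i _ [C mC <-]] /=.
  by rewrite setTI -comp_preimage -[X in measurable X]setTI; exact: mf.
by move=> /[apply].
Qed.

End measurable_rV.

Section rV_cons.
Context {R : realType}.

(* [measurableTypeR R] is [R] with the display on which [lebesgue_measure] is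
   declared; it is needed for the product [\x] below. *)
Definition rV_cons (d : nat) (p : measurableTypeR R * 'rV[R]_d) :
    'rV[R]_d.+1 :=
  row_mx (const_mx (p.1 : R) : 'rV[R]_1) p.2.

Lemma rV_cons0 (d : nat) p : @rV_cons d p ord0 ord0 = p.1.
Proof.
rewrite /rV_cons (_ : ord0 = lshift d (ord0 : 'I_1)); last exact/val_inj.
by rewrite (row_mxEl (const_mx p.1 : 'rV[R]_1) p.2) mxE.
Qed.

Lemma rV_consS (d : nat) p i : @rV_cons d p ord0 (lift ord0 i) = p.2 ord0 i.
Proof.
rewrite /rV_cons (_ : lift ord0 i = rshift 1 i); last exact/val_inj.
exact: (row_mxEr (const_mx p.1 : 'rV[R]_1) p.2).
Qed.

Lemma measurable_rV_cons (d : nat) : measurable_fun setT (@rV_cons d).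
Proof.
apply: measurable_fun_rV => i.
case: (unliftP (ord0 : 'I_d.+1) i) => [j ->|->].
  rewrite (_ : (fun x => _) = (fun v : 'rV[R]_d => v ord0 j) \o snd).
    apply: measurableT_comp; [exact: measurable_coord|exact: measurable_snd].
  by apply/funext => x /=; rewrite rV_consS.
rewrite (_ : (fun x => _) = fst); first exact: measurable_fst.
by apply/funext => x /=; rewrite rV_cons0.
Qed.

HB.instance Definition _ (d : nat) :=
  isMeasurableFun.Build _ _ _ _ (@rV_cons d) (@measurable_rV_cons d).

End rV_cons.

Section rV_lebesgue_step.
Context {R : realType} {d : nat}.
Variable mu : {sigma_finite_measure set 'rV[R]_d -> \bar R}.

Definition rV_lebesgue_step : set 'rV[R]_d.+1 -> \bar R :=
  pushforward (lebesgue_measure \x mu)%E (@rV_cons R d).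

Let step0 : rV_lebesgue_step set0 = 0%E.
Proof. exact: measure0. Qed.

Let step_ge0 A : (0 <= rV_lebesgue_step A)%E.
Proof. exact: measure_ge0. Qed.

Let step_sigma_additive : semi_sigma_additive rV_lebesgue_step.
Proof. exact: measure_semi_sigma_additive. Qed.

HB.instance Definition _ := isMeasure.Build _ _ _ rV_lebesgue_step
  step0 step_ge0 step_sigma_additive.

Let step_sigma_finite : sigma_finite setT rV_lebesgue_step.
Proof.
pose unc (v : 'rV[R]_d.+1) : measurableTypeR R * 'rV[R]_d :=
  (v ord0 ord0, \row_j v ord0 (lift ord0 j)).
have unc_cons p : unc (rV_cons p) = p.
  rewrite /unc rV_cons0 [RHS]surjective_pairing; congr pair.
  by apply/rowP => j; rewrite mxE rV_consS.
have munc : measurable_fun setT unc.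
  apply/measurable_fun_pairP; split; first exact: measurable_coord.
  apply: measurable_fun_rV => i.
  rewrite (_ : (fun x => _) = (fun v : 'rV[R]_d.+1 => v ord0 (lift ord0 i))).
    exact: measurable_coord.
  by apply/funext => v /=; rewrite mxE.
(* The library proves this too, but its instance is not inferred for [\x]. *)
have [F TF Foo] : sigma_finite setT (lebesgue_measure \x mu)%E.
  have /sigma_finiteP[F [TF ndF Foo]] := sigma_finiteT (@lebesgue_measure R).
  have /sigma_finiteP[G [TG ndG Goo]] := sigma_finiteT mu.
  exists (fun n => F n `*` G n).
    rewrite -setXTT TF TG predeqE => -[x y]; split.
      move=> [/= [n _ Fnx] [k _ Gky]]; exists (maxn n k) => //; split.
      - by move: x Fnx; exact/subsetPset/ndF/leq_maxl.
      - by move: y Gky; exact/subsetPset/ndG/leq_maxr.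
    by move=> [n _ []/= ? ?]; split; exists n.
  move=> k; have [? ?] := Foo k; have [? ?] := Goo k.
  split; first exact: measurableX.
  by rewrite product_measure1E// lte_mul_pinfty// ge0_fin_numE.
exists (fun n => unc @^-1` F n).
  by rewrite -preimage_bigcup -TF preimage_setT.
move=> n; have [mF Fn] := Foo n; split.
  by rewrite -[X in measurable X]setTI; exact: munc.
rewrite /rV_lebesgue_step /pushforward -comp_preimage.
by rewrite (_ : unc \o _ = id) ?preimage_id//; apply/funext => p /=.
Qed.

HB.instance Definition _ := Measure_isSigmaFinite.Build _ _ _ rV_lebesgue_step
  step_sigma_finite.

End rV_lebesgue_step.

(* Lebesgue measure on R^d: the d-fold product of the Lebesgue measure of R. *)
Fixpoint rV_lebesgue (R : realType) (d : nat) :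
    {sigma_finite_measure set 'rV[R]_d -> \bar R} :=
  match d with
  | 0%N => [the {sigma_finite_measure set 'rV[R]_0 -> \bar R} of \d_(0 : 'rV[R]_0)]
  | d'.+1 => [the {sigma_finite_measure set 'rV[R]_d'.+1 -> \bar R} of
               rV_lebesgue_step (rV_lebesgue R d')]
  end.

Section noises.
Context {disp : measure_display} {Omega : measurableType disp} {R : realType}.
Context {d : nat}.
Variable P : probability Omega R.

Definition mutually_independent (I : finType) (X : I -> {RV P >-> 'rV[R]_d}) :=
  forall (J : {set I}) (A : I -> set 'rV[R]_d),
    (forall i, i \in J -> measurable (A i)) ->
    P (\bigcap_(i in [set` J]) (X i @^-1` A i)) =
    (\prod_(i in J) P (X i @^-1` A i))%E.

Definition identically_distributed (I : Type)
    (X : I -> {RV P >-> 'rV[R]_d}) :=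
  forall i j A, measurable A ->
    distribution P (X i) A = distribution P (X j) A.

Definition symmetric_rv (X : {RV P >-> 'rV[R]_d}) :=
  forall A, measurable A ->
    distribution P X A = P ((fun w => - X w) @^-1` A).

Definition gradient_noise (p sigma : R) (K : nat)
    (nu : 'I_K -> {RV P >-> 'rV[R]_d}) :=
  [/\ mutually_independent nu,
      identically_distributed nu,
      forall i, distribution P (nu i) `<< rV_lebesgue R d,
      forall i, symmetric_rv (nu i) &
      forall i, ('E_P[fun w => (enorm (nu i w) `^ p)%R] <= (sigma `^ p)%:E)%E].

(* [c (j, k)] is the index of the k-th point of the j-th chunk. *)
Definition chunk_noise (M r K : nat) (c : 'I_M * 'I_r -> 'I_K)
    (nu : 'I_K -> {RV P >-> 'rV[R]_d}) (j : 'I_M) (w : Omega) : 'rV[R]_d :=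
  r%:R^-1 *: \sum_(k < r) nu (c (j, k)) w.

End noises.

Definition medoid_cost (R : realType) (d M : nat) (v : 'I_M -> 'rV[R]_d)
    (j : 'I_M) : R :=
  \sum_(i < M) enorm (v i - v j).

Definition is_medoid_index (R : realType) (d M : nat) (v : 'I_M -> 'rV[R]_d)
    (j : 'I_M) : Prop :=
  (forall i, medoid_cost v j <= medoid_cost v i) /\
  (forall i : 'I_M, (i < j)%N -> medoid_cost v j < medoid_cost v i).

(* Main.v *)
From HB Require Import structures.
Require Import Defs.
From mathcomp Require Import all_boot all_order all_algebra.
From mathcomp Require Import all_classical all_reals all_analysis.
From mathcomp Require Import measurable_realfun.
From mathcomp Require Import ring lra.

Set Implicit Arguments.
Unset Strict Implicit.
Unset Printing Implicit Defensive.

Import Order.TTheory GRing.Theory Num.Theory.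
Import numFieldNormedType.Exports.

Local Open Scope classical_set_scope.
Local Open Scope ring_scope.

(** Three facts combine into the bound.

    Each chunk noise has a small [p]-th moment: [E |nu_j|^p <= m^p] with
    [m = sigma / r^((p-1)/p)].  For [0 < p <= 2] the parallelogram law and the
    concavity of [t^(p/2)] give
    [|x + y|^p + |x - y|^p <= 2 (|x|^p + |y|^p)]; when [y] is symmetric and
    independent of [x], both terms on the left have the same expectation, so
    [p]-th moments of sums are subadditive with constant [1]
    ([moment_sum_symmetric], [chunk_noise_moment]).

    The medoid is robust: if at most [gamma M] of the [M] vectors have norm
    above [lam], comparing the cost of the medoid with that of any vector of
    norm at most [lam] gives [|nu_star| <= C lam] with
    [C = (3 - 2 gamma) / (1 - 2 gamma)] ([medoid_norm_le]).

    Many large vectors are unlikely: the chunk noises are independent, being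
    functions of disjoint blocks of the per-point noises
    ([disjoint_blocks_independent]), each exceeds [lam] with probability at
    most [q = (m / lam)^p] by Markov's inequality, and a Chernoff bound
    ([count_tail]) shows that more than [gamma M] of them exceed [lam] with
    probability at most [(q^gamma / h)^M], where
    [h = (1 - gamma)^(1 - gamma) gamma^gamma].

    Taking [lam = sqrt t / C] yields [P (|nu_star|^2 > t) <= (A^2 / t)^b] with
    [A = m C h^(-1/(p gamma))] and [b = p gamma M / 2 > 1].  Integrating this
    tail from [A^2] on, and the constant [1] before it, gives
    [E |nu_star|^2 <= A^2 (1 + 1 / (b - 1))] ([expectation_le_power_tail]).
    Since [h <= 1], [theta] in [(0, 1)] only enlarges the stated constant, as
    does the additional [3] in its numerator ([medoid_constant_le]). *)

(** * Euclidean norm and concave powers *)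

Section euclidean_norm.
Context {R : realType} {d : nat}.
Implicit Types u v : 'rV[R]_d.

Lemma enorm_ge0 v : 0 <= enorm v.
Proof. exact: sqrtr_ge0. Qed.

Lemma sqr_enorm v : enorm v ^+ 2 = \sum_(i < d) v ord0 i ^+ 2.
Proof. by rewrite sqr_sqrtr// sumr_ge0// => i _; exact: sqr_ge0. Qed.

Lemma enormN v : enorm (- v) = enorm v.
Proof. by congr Num.sqrt; apply: eq_bigr => i _; rewrite mxE sqrrN. Qed.

Lemma enormB u v : enorm (u - v) = enorm (v - u).
Proof. by rewrite -enormN opprB. Qed.

Lemma enorm0 : enorm (0 : 'rV[R]_d) = 0.
Proof.
by rewrite /enorm big1 ?sqrtr0// => i _; rewrite mxE expr0n.
Qed.

Lemma enormZ (a : R) v : enorm (a *: v) = `|a| * enorm v.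
Proof.
apply/eqP; rewrite -(@eqrXn2 _ 2)// ?mulr_ge0 ?enorm_ge0//.
rewrite exprMn real_normK ?num_real// !sqr_enorm mulr_sumr.
by apply/eqP/eq_bigr => i _; rewrite mxE exprMn.
Qed.

Lemma enorm_parallelogram u v :
  enorm (u + v) ^+ 2 + enorm (u - v) ^+ 2 = 2 * (enorm u ^+ 2 + enorm v ^+ 2).
Proof.
rewrite !sqr_enorm -!big_split mulr_sumr /=.
by apply: eq_bigr => i _; rewrite !mxE; ring.
Qed.

Lemma enorm_eq0 v : enorm v = 0 -> v = 0.
Proof.
move=> v0; apply/rowP => i; rewrite mxE.
apply/eqP; rewrite -(sqrf_eq0 (v ord0 i)).
have /eqP := sqr_enorm v; rewrite v0 expr0n/= eq_sym psumr_eq0; last first.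
  by move=> j _; exact: sqr_ge0.
by move=> /allP/(_ i)/=; apply; rewrite mem_index_enum.
Qed.

(** Expanding [|b u - a v|^2 >= 0] at [a = |u|], [b = |v|] and dividing by
    [2 |u| |v|]; zero vectors are treated apart because of that division. *)
Lemma enorm_cauchy_schwarz u v :
  \sum_(i < d) u ord0 i * v ord0 i <= enorm u * enorm v.
Proof.
have sqr_comb (a b : R) : \sum_(i < d) (b * u ord0 i - a * v ord0 i) ^+ 2 =
    b ^+ 2 * enorm u ^+ 2 + a ^+ 2 * enorm v ^+ 2
    - 2 * a * b * \sum_(i < d) u ord0 i * v ord0 i.
  rewrite !sqr_enorm !mulr_sumr -big_split -sumrB /=.
  by apply: eq_bigr => i _; ring.
have comb_ge0 (a b : R) : 0 <= \sum_(i < d) (b * u ord0 i - a * v ord0 i) ^+ 2.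
  by apply: sumr_ge0 => i _; exact: sqr_ge0.
have [u0|u_neq0] := eqVneq (enorm u) 0.
  by rewrite u0 mul0r (enorm_eq0 u0) big1// => i _; rewrite mxE mul0r.
have [v0|v_neq0] := eqVneq (enorm v) 0.
  by rewrite v0 mulr0 (enorm_eq0 v0) big1// => i _; rewrite mxE mulr0.
have uv_gt0 : 0 < enorm u * enorm v.
  by rewrite mulr_gt0// lt_neqAle eq_sym ?u_neq0 ?v_neq0 enorm_ge0.
have := comb_ge0 (enorm u) (enorm v); rewrite sqr_comb.
rewrite (_ : _ - _ = 2 * (enorm u * enorm v) *
  (enorm u * enorm v - \sum_(i < d) u ord0 i * v ord0 i)); last by ring.
by rewrite pmulr_rge0 ?subr_ge0// mulr_gt0.
Qed.

Lemma enorm_triangle u v : enorm (u + v) <= enorm u + enorm v.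
Proof.
rewrite -(@ler_pXn2r _ 2)// ?nnegrE ?addr_ge0 ?enorm_ge0//.
rewrite sqrrD !sqr_enorm.
rewrite (_ : \sum_(i < d) _ = \sum_(i < d) u ord0 i ^+ 2 +
   (\sum_(i < d) u ord0 i * v ord0 i) *+ 2 + \sum_(i < d) v ord0 i ^+ 2).
  by rewrite lerD2r lerD2l ler_pMn2r// enorm_cauchy_schwarz.
rewrite -sumrMnl -!big_split/=.
by apply: eq_bigr => i _; rewrite mxE sqrrD.
Qed.

Lemma enorm_triangleB u v : enorm u - enorm v <= enorm (u - v).
Proof. by rewrite lerBlDr -{1}(subrK v u) enorm_triangle. Qed.

Lemma measurable_enorm : measurable_fun setT (@enorm R d).
Proof.
rewrite (_ : @enorm R d = (@powR R ^~ 2^-1) \o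
    (fun v : 'rV[R]_d => \sum_(i < d) v ord0 i ^+ 2)); last first.
  by apply/funext => v /=; rewrite powR12_sqrt// -sqr_enorm sqr_ge0.
apply: measurableT_comp; first exact: measurable_powR.
apply: measurable_sum => i.
apply: measurable_funX; exact: measurable_coord.
Qed.

Lemma measurable_rVD disp (T : measurableType disp) (f g : T -> 'rV[R]_d) :
  measurable_fun setT f -> measurable_fun setT g ->
  measurable_fun setT (fun x => f x + g x).
Proof.
move=> mf mg; apply: measurable_fun_rV => i; under eq_fun do rewrite mxE.
by apply: measurable_funD;
  [exact: measurableT_comp (measurable_coord i) mf
  |exact: measurableT_comp (measurable_coord i) mg].
Qed.

Lemma measurable_rVZ disp (T : measurableType disp) (a : R)
    (f : T -> 'rV[R]_d) :
  measurable_fun setT f -> measurable_fun setT (fun x => a *: f x).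
Proof.
move=> mf; apply: measurable_fun_rV => i; under eq_fun do rewrite mxE.
apply: measurable_funM; first exact: measurable_cst.
exact: measurableT_comp (measurable_coord i) mf.
Qed.

Lemma measurable_rV_sum disp (T : measurableType disp) (I : Type) (s : seq I)
    (Q : pred I) (f : I -> T -> 'rV[R]_d) :
  (forall i, Q i -> measurable_fun setT (f i)) ->
  measurable_fun setT (fun x => \sum_(i <- s | Q i) f i x).
Proof.
move=> mf; apply: measurable_fun_rV => k.
under eq_fun do rewrite summxE.
elim: s => [|i s ih]; first by under eq_fun do rewrite big_nil; exact: measurable_cst.
under eq_fun do rewrite big_cons.
case: (boolP (Q i)) => Qi //; apply: measurable_funD => //.
exact: measurableT_comp (measurable_coord k) (mf _ Qi).
Qed.

End euclidean_norm.

Section power_mean.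
Context {R : realType}.
Implicit Types (a b q : R).

(** Each share [x = c / (a + b)] lies in [0, 1], so [x <= x^q], and the two
    shares add up to [1]. *)
Lemma powR_subadditive q a b : 0 < q <= 1 -> 0 <= a -> 0 <= b ->
  (a + b) `^ q <= a `^ q + b `^ q.
Proof.
move=> /andP[q0 q1] a0 b0.
have [ab0|ab_neq0] := eqVneq (a + b) 0.
  by rewrite ab0 powR0 ?gt_eqF// addr_ge0 ?powR_ge0.
have ab_gt0 : 0 < a + b by rewrite lt_neqAle eq_sym ab_neq0 addr_ge0.
have frac c : 0 <= c -> c <= a + b -> c / (a + b) * (a + b) `^ q <= c `^ q.
  rewrite le_eqVlt => /predU1P[<- _|c0 cab].
    by rewrite !mul0r powR_ge0.
  have cE : c = c / (a + b) * (a + b) by rewrite divfK.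
  rewrite [in leRHS]cE powRM ?divr_ge0 ?(ltW c0) ?(ltW ab_gt0)//.
  rewrite ler_wpM2r ?powR_ge0//; by apply: ger1_powR => //; rewrite divr_gt0//= ler_pdivrMr// mul1r.
rewrite -[leLHS]mul1r -(divff ab_neq0) mulrDl mulrDl lerD ?frac//.
  by rewrite lerDl.
by rewrite lerDr.
Qed.

(** Midpoint concavity of [t^q] is midpoint convexity of the inverse power
    [t^(1/q)] read at [a^q] and [b^q]. *)
Lemma powR_midpoint_concave q a b : 0 < q <= 1 -> 0 <= a -> 0 <= b ->
  a `^ q + b `^ q <= 2 * ((a + b) / 2) `^ q.
Proof.
move=> /andP[q0 q1] a0 b0.
have q0' : q != 0 by rewrite gt_eqF.
have half : (2^-1 : R) = 1 - 2^-1 by field.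
have conv : (2^-1 * a `^ q + 2^-1 * b `^ q) `^ q^-1 <=
    2^-1 * (a `^ q) `^ q^-1 + 2^-1 * (b `^ q) `^ q^-1.
  rewrite {2 4}half.
  apply: (convex_powR _ (Itv01 _ _)) => //=;
    rewrite ?inE/= ?in_itv/= ?powR_ge0// ?invr_ge0// ?invf_le1// ?ler1n//.
  by rewrite invf_ge1.
rewrite -!powRrM !divff// !powRr1// -!mulrDr in conv.
have := ge0_ler_powR (ltW q0) _ _ conv.
rewrite !nnegrE powR_ge0 mulr_ge0 ?addr_ge0// => /(_ isT isT).
rewrite -powRrM mulVf// powRr1 ?mulr_ge0 ?addr_ge0 ?powR_ge0//.
by rewrite ler_pdivrMl// (mulrC 2^-1).
Qed.

End power_mean.

(** * Independence of disjoint blocks *)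

Section independence.
Context {disp : measure_display} {Omega : measurableType disp} {R : realType}.
Variable P : probability Omega R.

(** The measures [E |-> P (E `&` F)] and [E |-> P E * P F] are finite, so
    agreement on a pi-system extends to the sigma-algebra it generates. *)
Lemma independence_of_pi_system (G : set (set Omega)) (F : set Omega) :
  G `<=` measurable -> setI_closed G -> G setT -> measurable F ->
  (forall E, G E -> P (E `&` F) = (P E * P F)%E) ->
  forall E, <<s G >> E -> P (E `&` F) = (P E * P F)%E.
Proof.
move=> Gm GI GT mF GF E sE.
have PF0 : 0 <= fine (P F) by rewrite fine_ge0// measure_ge0.
have scaleE A : mscale (NngNum PF0) P A = (P A * P F)%E.
  by rewrite /mscale/= fineK ?fin_num_measure// muleC.
rewrite -scaleE.
apply: (g_sigma_algebra_measure_unique G Gm (fun=> setT) (fun=> GT) _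
  (mrestr P mF) (mscale (NngNum PF0) P)) => //.
- by rewrite bigcup_const//; exists 0%N.
- by move=> A GA; apply: etrans (esym (scaleE A)); exact: GF.
- by move=> _; rewrite /= /mrestr setTI (le_lt_trans (probability_le1 _ _))// ltry.
Qed.

Context {d : nat} {I : finType}.
Variable X : I -> {RV P >-> 'rV[R]_d}.
Implicit Types b : {set I}.

(** Boxes in the coordinates of [b]: a pi-system generating the sigma-algebra
    of the subfamily indexed by [b].  Constraining all of [I] by measurable sets
    and intersecting over [b] only avoids dependent index types. *)
Definition block_boxes b : set (set Omega) :=
  [set E | exists A : I -> set 'rV[R]_d, (forall i, measurable (A i)) /\
     E = \bigcap_(i in [set` b]) (X i @^-1` A i)].

Definition block_sigma b : set (set Omega) := <<s block_boxes b >>.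

Lemma measurable_block_boxes b : block_boxes b `<=` measurable.
Proof.
move=> _ [A [mA ->]]; rewrite bigcap_mkcond.
apply: fin_bigcap_measurable => // i _.
by case: ifPn => // _; exact: measurable_funPTI.
Qed.

Lemma block_boxesI b : setI_closed (block_boxes b).
Proof.
move=> _ _ [A [mA ->]] [B [mB ->]]; exists (fun i => A i `&` B i); split.
  by move=> i; exact: measurableI.
by rewrite -bigcapI; apply: eq_bigcapr => i _; rewrite preimage_setI.
Qed.

Lemma block_boxesT b : block_boxes b setT.
Proof.
exists (fun=> setT); split => //.
by apply/esym; rewrite -subTset => w _ i _.
Qed.

Lemma measurable_block_sigma b : block_sigma b `<=` measurable.
Proof.
apply: smallest_sub; first exact: sigma_algebra_measurable.
exact: measurable_block_boxes.
Qed.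

Lemma block_sigma_subset b b' : b \subset b' -> block_sigma b `<=` block_sigma b'.
Proof.
move=> /fintype.subsetP bb'; apply: sub_smallest2r; first exact: smallest_sigma_algebra.
move=> _ [A [mA ->]].
exists (fun i => if i \in b then A i else setT); split.
  by move=> i; case: ifPn.
apply/seteqP; split => w /= h i.
  by case: ifPn => // ib _; exact: h.
by move=> /= ib; have := h i (bb' _ ib); rewrite /= ib.
Qed.

Lemma block_sigmaI b : setI_closed (block_sigma b).
Proof.
by move=> E F; exact: (@measurableI _ (g_sigma_algebraType (block_boxes b))).
Qed.

Lemma block_sigmaT b : block_sigma b setT.
Proof. exact: sub_sigma_algebra (block_boxesT b). Qed.

(** Measurability of the sum is taken with respect to the sigma-algebra of the
    block, that is, on [Omega] equipped with [block_boxes b] as generators. *)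
Lemma block_sigma_sum b (s : seq I) (B : set 'rV[R]_d) : {subset s <= b} ->
  measurable B -> block_sigma b ((fun w => \sum_(i <- s) X i w) @^-1` B).
Proof.
move=> sb mB.
have mX i : i \in b ->
    measurable_fun [set: g_sigma_algebraType (block_boxes b)] (X i).
  move=> ib _ A mA; rewrite setTI; apply: sub_sigma_algebra.
  exists (fun j => if j == i then A else setT); split.
    by move=> j; case: ifPn.
  apply/seteqP; split => w /= h.
    by move=> j /= _; case: eqP => [->|].
  by have := h i ib; rewrite /= eqxx.
have mS : measurable_fun [set: g_sigma_algebraType (block_boxes b)]
    (fun w => \sum_(i <- s) X i w).
  under eq_fun do rewrite big_seq.
  by apply: measurable_rV_sum => i /sb/mX.
by have := mS measurableT _ mB; rewrite setTI.
Qed.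

Hypothesis X_indep : mutually_independent X.

(** Two boxes on disjoint blocks form one box on the union, to which mutual
    independence applies. *)
Lemma block_boxes_independent b b' E F : [disjoint b & b']%B ->
  block_boxes b E -> block_boxes b' F -> P (E `&` F) = (P E * P F)%E.
Proof.
move=> bb' [A [mA ->]] [B [mB ->]].
rewrite !X_indep//.
pose C i := if i \in b then A i else B i.
have mC i : measurable (C i) by rewrite /C; case: ifPn.
have notb i : i \in b' -> i \in b = false by move=> ib'; rewrite (disjointFl bb').
rewrite (_ : _ `&` _ = \bigcap_(i in [set` (b :|: b')%SET]) (X i @^-1` C i)).
  rewrite X_indep// (big_setID b)/=; congr (_ * _)%E.
    by rewrite finset.setUK; apply: eq_bigr => i ib; rewrite /C ib.
  apply: congr_big => // i; last first.
    by rewrite !inE => /andP[/negbTE ib _]; rewrite /C ib.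
  rewrite !inE; have [ib'|_] := boolP (i \in b'); first by rewrite notb.
  by rewrite orbF andNb.
apply/seteqP; split=> w /=.
  move=> [wA wB] i /=; rewrite !inE /C => /orP[ib|ib']; first by rewrite ib; exact: wA.
  by rewrite notb//; exact: wB.
move=> wC; split=> i /= ib.
  by have := wC i; rewrite /= !inE /C ib; exact.
by have := wC i; rewrite /= !inE /C ib notb// => /(_ isT).
Qed.

(** The pi-system argument is applied once in each variable. *)
Lemma block_sigma_independent b b' E F : [disjoint b & b']%B ->
  block_sigma b E -> block_sigma b' F -> P (E `&` F) = (P E * P F)%E.
Proof.
move=> bb' sE sF; rewrite setIC muleC.
apply: (independence_of_pi_system (@measurable_block_boxes b')
  (@block_boxesI b') (block_boxesT b') (measurable_block_sigma sE) _ sF).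
move=> F' bF'; rewrite setIC muleC.
apply: (independence_of_pi_system (@measurable_block_boxes b)
  (@block_boxesI b) (block_boxesT b) (measurable_block_boxes bF') _ sE).
by move=> E' bE'; exact: (block_boxes_independent bb').
Qed.

(** The events of all blocks but one live in the sigma-algebra of the union of
    their blocks, hence are jointly independent of the remaining one; this
    peels off one factor at a time. *)
Lemma disjoint_blocks_independent (J : finType) (b : J -> {set I})
    (E : J -> set Omega) (S : {set J}) :
  (forall j k, j != k -> [disjoint b j & b k]%B) ->
  (forall j, block_sigma (b j) (E j)) ->
  P (\bigcap_(j in [set` S]) E j) = (\prod_(j in S) P (E j))%E.
Proof.
move=> bdisj sE.
rewrite -big_enum/= (_ : [set` S] = [set` enum S]); last first.
  by apply/seteqP; split => j /=; rewrite mem_enum.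
rewrite bigcap_seq.
have := enum_uniq S; elim: (enum S) => [|j s ih].
  by rewrite !big_nil probability_setT.
rewrite /= => /andP[js us]; rewrite !big_cons -(ih us).
apply: (@block_sigma_independent (b j) (\bigcup_(k in s) b k)%SET) => //.
  rewrite bigcup_disjoint// => k ks; apply: bdisj.
  by apply: contraNneq js => ->.
have sub k : k \in s -> block_sigma (\bigcup_(k in s) b k)%SET (E k).
  by move=> ks; apply: block_sigma_subset (sE k); exact: (finset.bigcup_sup k).
rewrite big_seq; apply: big_ind => //; first exact: block_sigmaT.
exact: block_sigmaI.
Qed.

End independence.

(** * Moments of sums of symmetric independent vectors *)

Section symmetric_moment.
Context {disp : measure_display} {Omega : measurableType disp} {R : realType}.
Variable P : probability Omega R.
Context {d : nat}.

(** By independence the pairs [(S, Y)] and [(S, - Y)] both have as law the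
    product of the laws of [S] and [Y], the latter being symmetric. *)
Lemma integral_symmetric_flip (S Y : {RV P >-> 'rV[R]_d})
    (f : 'rV[R]_d * 'rV[R]_d -> \bar R) :
  (forall A B, measurable A -> measurable B ->
     P (S @^-1` A `&` Y @^-1` B) = (P (S @^-1` A) * P (Y @^-1` B))%E) ->
  symmetric_rv Y -> measurable_fun setT f -> (forall z, 0 <= f z)%E ->
  (\int[P]_w f (S w, Y w) = \int[P]_w f (S w, (- Y w)%R))%E.
Proof.
move=> SY Ysym mf f0.
have mN : measurable_fun setT (fun v : 'rV[R]_d => - v).
  rewrite (_ : (fun v => - v) = (fun v : 'rV[R]_d => -1 *: v)).
    by apply: measurable_rVZ; exact: measurable_id.
  by apply/funext => v; rewrite scaleN1r.
have mS : measurable_fun setT S by [].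
have mY : measurable_fun setT Y by [].
have mSY : measurable_fun setT (fun w => (S w, Y w)) by exact: measurable_fun_pair.
have mSNY : measurable_fun setT (fun w => (S w, - Y w)).
  by apply: measurable_fun_pair => //; exact: measurableT_comp mN mY.
pose SYrv : {RV P >-> _} := HB.pack (fun w => (S w, Y w)) (isMeasurableFun.Build _ _ _ _ _ mSY).
pose SNYrv : {RV P >-> _} := HB.pack (fun w => (S w, - Y w)) (isMeasurableFun.Build _ _ _ _ _ mSNY).
have preimN B : (fun w => - Y w) @^-1` B = Y @^-1` ((fun v => - v) @^-1` B) by [].
transitivity (\int[distribution P SYrv]_z f z)%E.
  by rewrite ge0_integral_distribution.
transitivity (\int[distribution P SNYrv]_z f z)%E; last first.
  by rewrite ge0_integral_distribution.
apply: eq_measure_integral => A mA _.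
apply: (@etrans _ _ ((distribution P S \x distribution P Y)%E A)).
  by apply: esym; apply: product_measure_unique.
apply: product_measure_unique => // B C mB mC.
transitivity (P (S @^-1` B `&` Y @^-1` ((fun v => - v) @^-1` C))) => //.
rewrite SY//; last by rewrite -[X in measurable X]setTI; exact: mN.
by congr (_ * _)%E; rewrite -preimN; apply/esym/Ysym.
Qed.

(** With [q = p / 2 <= 1] this is midpoint concavity of [t^q] at the two squared
    norms, whose mean is [|u|^2 + |v|^2] by the parallelogram law, followed by
    subadditivity of [t^q]. *)
Lemma enorm_powR_two_point (p : R) (u v : 'rV[R]_d) : 0 < p <= 2 ->
  enorm (u + v) `^ p + enorm (u - v) `^ p <= 2 * (enorm u `^ p + enorm v `^ p).
Proof.
move=> /andP[p0 p2].
have half : 0 < p / 2 <= 1 by lra.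
have powE (w : 'rV[R]_d) : enorm w `^ p = (enorm w ^+ 2) `^ (p / 2).
  by rewrite -powR_mulrn ?enorm_ge0// -powRrM mulrC divfK.
rewrite !powE (le_trans (powR_midpoint_concave half _ _)) ?sqr_ge0//.
rewrite enorm_parallelogram mulrAC divff// mul1r ler_pM2l//.
by rewrite powR_subadditive ?sqr_ge0.
Qed.

Lemma measurable_enorm_powR disp' (T : measurableType disp') (p : R)
    (f : T -> 'rV[R]_d) : measurable_fun setT f ->
  measurable_fun setT (fun x => (enorm (f x) `^ p)%R%:E).
Proof.
move=> mf; apply/measurable_EFinP.
apply: (@measurableT_comp _ _ _ _ _ _ (@powR R ^~ p)); first exact: measurable_powR.
exact: measurableT_comp measurable_enorm mf.
Qed.

(** Averaging [|S + Y|^p] with [|S - Y|^p], which has the same expectation,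
    turns the two-point inequality into subadditivity of moments. *)
Lemma moment_add_symmetric (p : R) (S Y : {RV P >-> 'rV[R]_d}) : 0 < p <= 2 ->
  (forall A B, measurable A -> measurable B ->
     P (S @^-1` A `&` Y @^-1` B) = (P (S @^-1` A) * P (Y @^-1` B))%E) ->
  symmetric_rv Y ->
  (\int[P]_w (enorm (S w + Y w) `^ p)%R%:E <=
   \int[P]_w (enorm (S w) `^ p)%R%:E + \int[P]_w (enorm (Y w) `^ p)%R%:E)%E.
Proof.
move=> p02 SY Ysym.
have mN : measurable_fun setT (fun w => - Y w).
  under eq_fun do rewrite -scaleN1r.
  exact: measurable_rVZ.
pose f (z : 'rV[R]_d * 'rV[R]_d) := (enorm (z.1 + z.2) `^ p)%R%:E.
have mf : measurable_fun setT f.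
  by apply: measurable_enorm_powR; apply: measurable_rVD.
have flip : (\int[P]_w (enorm (S w + Y w) `^ p)%R%:E =
             \int[P]_w (enorm (S w - Y w) `^ p)%R%:E)%E.
  apply: (integral_symmetric_flip (f := f)) => // z.
  by rewrite lee_fin powR_ge0.
have m1 : measurable_fun setT (fun w => (enorm (S w + Y w) `^ p)%R%:E).
  by apply: measurable_enorm_powR; exact: measurable_rVD.
have m2 : measurable_fun setT (fun w => (enorm (S w - Y w) `^ p)%R%:E).
  by apply: measurable_enorm_powR; exact: measurable_rVD.
have m3 (Z : {RV P >-> 'rV[R]_d}) : measurable_fun setT (fun w => (enorm (Z w) `^ p)%R%:E).
  exact: measurable_enorm_powR.
have ge0 (Z : Omega -> 'rV[R]_d) w : (0 <= (enorm (Z w) `^ p)%R%:E)%E.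
  by rewrite lee_fin powR_ge0.
have two0 : (0 < 2%:E :> \bar R)%E by rewrite lte_fin.
have two_fin : (2%:E : \bar R) \is a fin_num by [].
rewrite -(lee_pmul2l two_fin two0).
have sum_flip : (\int[P]_w ((enorm (S w + Y w) `^ p)%R%:E +
      (enorm (S w - Y w) `^ p)%R%:E) =
    2%:E * \int[P]_w (enorm (S w + Y w) `^ p)%R%:E)%E.
  rewrite (ge0_integralD P measurableT _ m1 _ m2).
  - by rewrite -flip mule_natl mule2n.
  - by move=> w _; exact: (ge0 (fun w => S w + Y w)).
  - by move=> w _; exact: (ge0 (fun w => S w - Y w)).
have sum_SY : (\int[P]_w ((enorm (S w) `^ p)%R%:E + (enorm (Y w) `^ p)%R%:E) =
    \int[P]_w (enorm (S w) `^ p)%R%:E + \int[P]_w (enorm (Y w) `^ p)%R%:E)%E.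
  apply: (ge0_integralD P measurableT _ (m3 S) _ (m3 Y)).
  - by move=> w _; exact: ge0.
  - by move=> w _; exact: ge0.
rewrite -sum_flip -sum_SY.
have mSY : measurable_fun setT
    (fun w => (enorm (S w) `^ p)%R%:E + (enorm (Y w) `^ p)%R%:E)%E.
  exact: emeasurable_funD.
have SY0 w : (0 <= (enorm (S w) `^ p)%R%:E + (enorm (Y w) `^ p)%R%:E)%E.
  by rewrite -EFinD lee_fin addr_ge0 ?powR_ge0.
have scale_SY : (\int[P]_w (2%:E * ((enorm (S w) `^ p)%R%:E + (enorm (Y w) `^ p)%R%:E)) =
    2%:E * \int[P]_w ((enorm (S w) `^ p)%R%:E + (enorm (Y w) `^ p)%R%:E))%E.
  by apply: ge0_integralZl_EFin.
rewrite -scale_SY.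
apply: ge0_le_integral.
- exact: measurableT.
- by move=> w _; rewrite -EFinD lee_fin addr_ge0 ?powR_ge0.
- exact: emeasurable_funD.
- exact: measurable_funeM.
- by move=> w _; rewrite -!EFinD -EFinM lee_fin; exact: enorm_powR_two_point.
Qed.

Lemma moment_sum_symmetric (I : finType) (X : I -> {RV P >-> 'rV[R]_d}) (p : R)
    (s : seq I) : 0 < p <= 2 -> mutually_independent X ->
  (forall i, symmetric_rv (X i)) -> uniq s ->
  (\int[P]_w (enorm (\sum_(i <- s) X i w) `^ p)%R%:E <=
   \sum_(i <- s) \int[P]_w (enorm (X i w) `^ p)%R%:E)%E.
Proof.
move=> p02 Xind Xsym.
have p0 : p != 0 by case/andP: p02 => p0 _; rewrite gt_eqF.
elim: s => [_|i s ih].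
  rewrite big_nil; under eq_integral do rewrite big_nil enorm0 powR0//.
  by rewrite integral0.
rewrite cons_uniq => /andP[/negbTE si us].
have mS : measurable_fun setT (fun w => \sum_(j <- s) X j w).
  exact: measurable_rV_sum.
pose S : {RV P >-> 'rV[R]_d} := HB.pack (fun w => \sum_(j <- s) X j w)
  (isMeasurableFun.Build _ _ _ _ _ mS).
rewrite big_cons addeC.
apply: le_trans (leeD2r _ (ih us)).
under eq_integral do rewrite big_cons addrC.
apply: (@moment_add_symmetric p S (X i)) => // A B mA mB.
apply: (block_sigma_independent Xind
  (b := [set j in s]%SET) (b' := [set i]%SET)).
- by rewrite disjoint_sym disjoints1 inE si.
- by apply: block_sigma_sum => // j js; rewrite inE.
- rewrite (_ : X i @^-1` B = (fun w => \sum_(j <- [:: i]) X j w) @^-1` B).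
    by apply: block_sigma_sum => // j; rewrite !inE.
  by apply/seteqP; split => w /=; rewrite big_seq1.
Qed.

End symmetric_moment.

(** * A Chernoff bound for the number of events *)

Section count_tail.
Context {disp : measure_display} {Omega : measurableType disp} {R : realType}.
Variable P : probability Omega R.

Lemma measurable_count (J : finType) (B : J -> set Omega) :
  (forall j, measurable (B j)) ->
  measurable_fun setT (fun w => #|[set j | w \in B j]%SET|%:R : R).
Proof.
move=> mB; rewrite (_ : (fun w => _) = fun w => \sum_(j : J) \1_(B j) w).
  by apply: measurable_sum => j; exact: measurable_indic.
apply/funext => w; rewrite -sum1_card natr_sum big_mkcond/=.
by apply: eq_bigr => j _; rewrite inE indicE; case: ifPn.
Qed.

(** Chernoff's method with the tilt [s = gamma / ((1 - gamma) q)].  The number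
    [N] of events that occur satisfies
    [s^N = \sum_S (s - 1)^|S| * \1_(\bigcap_(j in S) B j)],
    so only the probabilities of intersections are needed, and
    [E s^N <= (1 + (s - 1) q)^|J| <= (1 - gamma)^(-|J|)].  When [s <= 1] the
    right-hand side is at least [1]. *)
Lemma count_tail (J : finType) (B : J -> set Omega) (q gamma : R) :
  0 < gamma < 1 -> 0 < q -> (forall j, measurable (B j)) ->
  (forall S : {set J}, (P (\bigcap_(j in [set` S]) B j) <= (q ^+ #|S|)%:E)%E) ->
  (P [set w | (gamma * #|J|%:R < #|[set j | w \in B j]%SET|%:R)%R] <=
   ((q `^ gamma / ((1 - gamma) `^ (1 - gamma) * gamma `^ gamma)) ^+ #|J|)%:E)%E.
Proof.
move=> /andP[gamma0 gamma1] q0 mB capB.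
have gamma1' : 0 < 1 - gamma by rewrite subr_gt0.
pose N w : R := #|[set j | w \in B j]%SET|%:R.
have mE : measurable [set w | (gamma * #|J|%:R < N w)%R].
  rewrite -[X in measurable X]setTI; apply: measurable_fun_ltr => //.
  exact: measurable_count.
have h0 : 0 < (1 - gamma) `^ (1 - gamma) * gamma `^ gamma.
  by rewrite mulr_gt0// powR_gt0.
have hE : (1 - gamma) `^ (1 - gamma) * gamma `^ gamma =
    (1 - gamma) * (gamma / (1 - gamma)) `^ gamma.
  rewrite powRM ?invr_ge0 ?(ltW gamma0) ?(ltW gamma1')//.
  rewrite -(powR_inv1 (ltW gamma1')) -powRrM mulN1r.
  rewrite -[X in _ = X * _](powRr1 (ltW gamma1')) mulrCA mulrC -powRD//.
  by apply/implyP => _; rewrite gt_eqF.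
(* For q >= gamma / (1 - gamma) the bound is trivial: q^gamma divided by
   (1 - gamma)^(1 - gamma) gamma^gamma is at least 1 / (1 - gamma). *)
have [q_large|q_small] := leP (gamma / (1 - gamma)) q.
  apply: (le_trans (probability_le1 _ mE)); rewrite lee_fin exprn_ege1//.
  rewrite ler_pdivlMr// mul1r.
  rewrite hE.
  apply: (@le_trans _ _ ((gamma / (1 - gamma)) `^ gamma)).
    by rewrite ler_piMl ?powR_ge0//; lra.
  apply: ge0_ler_powR => //; rewrite ?nnegrE ?(ltW q0)//; first exact: ltW.
  by rewrite divr_ge0// ltW.
pose s := gamma / (1 - gamma) / q.
have s1 : 1 < s by rewrite ltr_pdivlMr// mul1r.
have s0 : 0 < s by rewrite (lt_trans _ s1).
have sq : s * q = gamma / (1 - gamma) by rewrite divfK// gt_eqF.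
pose a := s `^ (gamma * #|J|%:R).
have a0 : 0 < a by rewrite powR_gt0.
pose BS (S : {set J}) := \bigcap_(j in [set` S]) B j.
have mBS S : measurable (BS S).
  rewrite /BS bigcap_mkcond; apply: fin_bigcap_measurable => // j _.
  by case: ifPn.
pose c (S : {set J}) : R := (s - 1) ^+ #|S| / a.
have c_ge0 S : 0 <= c S by rewrite divr_ge0 ?exprn_ge0 ?(ltW a0)// subr_ge0 ltW.
have pow_count w : s `^ (N w) = \sum_(S : {set J}) (s - 1) ^+ #|S| * \1_(BS S) w.
  transitivity (\prod_(j : J) ((s - 1) * \1_(B j) w + 1)).
    rewrite powR_mulrn ?ltW// -prodr_const big_mkcond/=.
    apply: eq_bigr => j _; rewrite inE indicE.
    by case: ifPn => _; rewrite ?mulr1 ?subrK// mulr0 add0r.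
  rewrite bigA_distr; apply: eq_bigr => S _.
  rewrite -big_mkcond/= big_split/= prodr_const; congr (_ * _).
  rewrite indicE; have [wS|wS] := boolP (w \in BS S).
    rewrite big1// => j jS; rewrite indicE mem_set//.
    by move: wS; rewrite inE => /(_ j); exact.
  move: wS; rewrite notin_setE => /existsNP[j /not_implyP[/= jS Bj]].
  by rewrite (bigD1 j)//= indicE memNset// mul0r.
have indic_le w : \1_[set w | (gamma * #|J|%:R < N w)%R] w <=
    \sum_(S : {set J}) c S * \1_(BS S) w.
  rewrite (_ : \sum_S _ = s `^ (N w) / a); last first.
    by rewrite pow_count mulr_suml; apply: eq_bigr => S _; rewrite mulrAC.
  rewrite indicE; have [|_] := boolP (_ \in _); last first.
    by rewrite divr_ge0 ?powR_ge0// ltW.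
  rewrite inE/= => /ltW Nw; rewrite ler_pdivlMr// mul1r.
  by rewrite ler_powR// ltW.
rewrite (_ : P _ = \int[P]_w (\1_[set w | (gamma * #|J|%:R < N w)%R] w)%:E)%E;
  last by rewrite integral_indic// setIT.
apply: (@le_trans _ _ (\int[P]_w \sum_(S : {set J}) (c S * \1_(BS S) w)%:E)%E).
  apply: ge0_le_integral => //.
  - apply/measurable_EFinP; exact: measurable_indic.
  - apply: emeasurable_sum => S; apply/measurable_EFinP.
    by apply: measurable_funM => //; exact: measurable_indic.
  - by move=> w _; rewrite sumEFin lee_fin.
rewrite ge0_integral_sum//; last 2 first.
- by move=> S; apply/measurable_EFinP; apply: measurable_funM => //; exact: measurable_indic.
- by move=> S w _; rewrite lee_fin mulr_ge0.
apply: (@le_trans _ _ (\sum_(S : {set J}) (c S * q ^+ #|S|)%:E)%E).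
  apply: lee_sum => S _; under eq_integral do rewrite EFinM.
  rewrite ge0_integralZl_EFin//; last first.
    by apply/measurable_EFinP; exact: measurable_indic.
  rewrite integral_indic// setIT (EFinM (c S)).
  by apply: lee_wpmul2l; [rewrite lee_fin|exact: capB].
rewrite sumEFin lee_fin.
have -> : \sum_(S : {set J}) c S * q ^+ #|S| = ((s - 1) * q + 1) ^+ #|J| / a.
  rewrite -prodr_const bigA_distr mulr_suml; apply: eq_bigr => S _.
  by rewrite -big_mkcond/= prodr_const exprMn mulrAC.
have aE : a = (s `^ gamma) ^+ #|J| by rewrite /a powRrM powR_mulrn ?powR_ge0.
rewrite aE -expr_div_n; apply: lerXn2r; rewrite ?nnegrE.
- by rewrite divr_ge0 ?powR_ge0// addr_ge0// mulr_ge0 ?(ltW q0)// subr_ge0 ltW.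
- by rewrite divr_ge0 ?powR_ge0// ltW.
rewrite ler_pdivrMr ?powR_gt0// mulrAC -powRM ?(ltW q0) ?(ltW s0)//.
rewrite (mulrC q) sq hE invfM mulrCA divff ?mulr1 ?gt_eqF ?powR_gt0 ?divr_gt0//.
(* Drop the term - q from (s - 1) q + 1 <= s q + 1 = 1 / (1 - gamma). *)
rewrite -[leRHS](subrK 1).
have -> : (1 - gamma)^-1 - 1 = s * q.
  by rewrite sq; field; rewrite gt_eqF.
by rewrite lerD2r ler_wpM2r ?(ltW q0)// gerBl.
Qed.

End count_tail.

(** * Robustness of the medoid *)

Section medoid.
Context {R : realType} {d M : nat}.
Implicit Types (v : 'I_M -> 'rV[R]_d).

(** Let [b] be the number of bad indices and [x] the norm of the medoid.
    Against a good vector [v g], every bad index [i] costs at most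
    [|v i| + lam] and every good one at most [2 lam], while for the medoid they
    cost at least [|v i| - x] and [x - lam].  The norms of the bad vectors
    cancel and leave [(M - 2 b) x <= (3 M - 2 b) lam], which is weakest at
    [b = gamma M]. *)
Lemma medoid_norm_le v (j : 'I_M) (gamma lam : R) :
  (forall i, medoid_cost v j <= medoid_cost v i) ->
  0 <= lam -> 0 < gamma < 1 / 2 ->
  #|[set i | lam < enorm (v i)]%SET|%:R <= gamma * M%:R ->
  enorm (v j) <= (3 - 2 * gamma) / (1 - 2 * gamma) * lam.
Proof.
move=> jmin lam0 /andP[gamma0 gamma_half] bad_le.
set bad := [set i | lam < enorm (v i)]%SET in bad_le.
have M_gt0 : 0 < M%:R :> R by rewrite ltr0n; apply: leq_ltn_trans (ltn_ord j).
have card_good : #|~: bad|%:R = M%:R - #|bad|%:R :> R.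
  by apply/eqP; rewrite eq_sym subr_eq -natrD addnC cardsC card_ord.
have [g gP] : exists g, g \in ~: bad.
  apply/set0Pn; rewrite -card_gt0 -(ltr0n R) card_good subr_gt0.
  by apply: le_lt_trans bad_le _; rewrite gtr_pMl//; lra.
have goodP i : i \in ~: bad -> enorm (v i) <= lam by rewrite !inE -leNgt.
have := jmin g; rewrite /medoid_cost.
rewrite (bigID (mem bad)) [leRHS](bigID (mem bad))/= => cost_le.
have lower : \sum_(i in bad) (enorm (v i) - enorm (v j)) +
    \sum_(i | i \notin bad) (enorm (v j) - lam) <=
    \sum_(i in bad) enorm (v i - v j) + \sum_(i | i \notin bad) enorm (v i - v j).
  apply: lerD; apply: ler_sum => i ib; first exact: enorm_triangleB.
  rewrite enormB (le_trans _ (enorm_triangleB _ _))// lerD2l lerN2.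
  by rewrite goodP// inE.
have upper : \sum_(i in bad) enorm (v i - v g) + \sum_(i | i \notin bad) enorm (v i - v g) <=
    \sum_(i in bad) (enorm (v i) + lam) + \sum_(i | i \notin bad) (lam + lam).
  have dist i : enorm (v i - v g) <= enorm (v i) + lam.
    by rewrite (le_trans (enorm_triangle _ _))// enormN lerD2l goodP.
  apply: lerD; apply: ler_sum => i ib//.
  by rewrite (le_trans (dist i))// lerD2r goodP// inE.
have := le_trans lower (le_trans cost_le upper).
have sum_bad (x : R) : \sum_(i in bad) x = #|bad|%:R * x.
  by rewrite sumr_const mulr_natl.
have sum_good (x : R) : \sum_(i | i \notin bad) x = (M%:R - #|bad|%:R) * x.
  rewrite -card_good sumr_const mulr_natl; congr (_ *+ _).
  by apply: eq_card => i; rewrite finset.in_setC.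
rewrite [X in X + _ <= _]big_split [X in _ <= X + _]big_split /=.
rewrite !sum_bad !sum_good => main.
have {}main : #|bad|%:R * - enorm (v j) + (M%:R - #|bad|%:R) * (enorm (v j) - lam) <=
    #|bad|%:R * lam + (M%:R - #|bad|%:R) * (lam + lam).
  by move: main; rewrite -!addrA lerD2l.
rewrite mulrAC ler_pdivlMr; last lra.
set b : R := #|bad|%:R in bad_le main *; set m : R := M%:R in bad_le main M_gt0 *.
set x := enorm (v j) in main *.
have x0 : 0 <= x := enorm_ge0 _.
have : x * (m - 2 * b) <= lam * (3 * m - 2 * b) by nra.
move=> xb.
(* The constant (3 - 2 gamma) / (1 - 2 gamma) exceeds 1. *)
have [xl|/ltW lx] := leP x lam; first by nra.
have : (x - lam) * (2 * (gamma * m - b)) >= 0.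
  by rewrite mulr_ge0// ?subr_ge0// mulr_ge0// subr_ge0.
move=> h.
have : m * (x * (1 - 2 * gamma)) <= m * ((3 - 2 * gamma) * lam) by lra.
by rewrite ler_pM2l.
Qed.

End medoid.

(** * Expectation under a power tail *)

Section power_tail.
Context {R : realType}.
Local Notation mu := (@lebesgue_measure R).

Lemma cvg_powR_pinfty (a : R) : a < 0 -> t `^ a @[t --> +oo%R] --> (0 : R).
Proof.
move=> a0; have Na0 : 0 < - a by rewrite oppr_gt0.
apply/cvgrPdist_le => e e0; near=> t.
have t_gt0 : 0 < t by near: t; exact: nbhs_pinfty_gt.
rewrite sub0r normrN ger0_norm ?powR_ge0//.
rewrite -[a]opprK powRN invf_ple ?posrE ?powR_gt0//.
have te : (e^-1) `^ (- a)^-1 <= t by near: t; apply: nbhs_pinfty_ge; exact: num_real.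
have := ge0_ler_powR (ltW Na0) _ _ te.
rewrite !nnegrE powR_ge0 (ltW t_gt0) => /(_ isT isT).
by rewrite -powRrM mulVf ?gt_eqF// powRr1// invr_ge0 ltW.
Unshelve. all: by end_near. Qed.

(** The antiderivative [B^b / (1 - b) * t^(1 - b)] vanishes at infinity. *)
Lemma integral_powR_tail (B b : R) : 0 < B -> 1 < b ->
  (\int[mu]_(t in `[B, +oo[) (B `^ b * t `^ (- b))%R%:E = (B / (b - 1))%:E)%E.
Proof.
move=> B0 b1; have b1' : 1 - b < 0 by rewrite subr_lt0.
have b1_neq0 : 1 - b != 0 by rewrite lt_eqF.
pose f t := B `^ b * t `^ (- b).
pose F t := B `^ b / (1 - b) * t `^ (1 - b).
have dF (x : R) : 0 < x -> is_derive x 1 F (f x).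
  move=> x0; rewrite /F /f.
  have dP : is_derive x (1 : R) (@powR R ^~ (1 - b)) ((1 - b) * x `^ (1 - b - 1)).
    exact: is_derive1_powR.
  apply: is_derive_eq.
  rewrite /GRing.scale/= mulrA divfK//.
  by rewrite (_ : 1 - b - 1 = - b)//; ring.
have df (x : R) : 0 < x -> derivable f x 1.
  move=> x0; apply: derivableM; first exact: derivable_cst.
  by apply: derivable_powR; rewrite in_itv/= x0.
rewrite (@ge0_continuous_FTC2y _ f F B 0).
- rewrite sub0e -EFinN; congr (_%:E); rewrite /F -mulNr.
  rewrite powRD; last by apply/implyP => _; rewrite gt_eqF.
  rewrite powRN powRr1 ?(ltW B0)//; have := powR_gt0 b B0.
  move: (B `^ b) => u u0; field.
  by rewrite b1_neq0 (gt_eqF u0) -oppr_eq0 opprB b1_neq0.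
- by move=> t _; rewrite mulr_ge0// powR_ge0.
- apply: continuous_in_subspaceT => x; rewrite inE/= in_itv/= andbT => Bx.
  by apply/differentiable_continuous/derivable1_diffP/df; exact: lt_le_trans Bx.
- rewrite -(mulr0 (B `^ b / (1 - b))); apply: cvgM; first exact: cvg_cst.
  exact: cvg_powR_pinfty.
- by move=> x Bx; have [] := dF x (lt_trans B0 Bx).
- apply: cvg_at_right_filter; apply/differentiable_continuous/derivable1_diffP.
  by have [] := dF B B0.
- move=> x; rewrite in_itv/= andbT => Bx; rewrite derive1E.
  by have [] := dF x (lt_trans B0 Bx).
Qed.

(** The expectation is the integral of the tail, bounded by [1] on [[0, B[] and
    by the power [(B / t)^b] beyond. *)
Lemma expectation_le_power_tail disp (Omega : measurableType disp)
    (P : probability Omega R) (X : {RV P >-> R}) (B b : R) :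
  0 < B -> 1 < b -> (forall w, 0 <= X w) ->
  (forall t, 0 < t -> (P [set w | (t < X w)%R] <= (B `^ b * t `^ (- b))%R%:E)%E) ->
  ('E_P[X] <= (B * (1 + (b - 1)^-1))%:E)%E.
Proof.
move=> B0 b1 X0 tail.
have mccdf D : measurable D -> measurable_fun D (ccdf X).
  by move=> mD; apply: measurable_funTS; exact: ccdf_measurable.
rewrite ge0_expectation_ccdf// (@itv_bndbnd_setU _ _ _ (BLeft B))//; last first.
  by rewrite bnd_simp ltW.
rewrite ge0_integral_setU//=; last 2 first.
- by apply: mccdf; exact: measurableU.
- apply/disj_setPS => t [] /=; rewrite !in_itv/= => /andP[_ tB] /andP[Bt _].
  by move: tB; rewrite ltNge Bt.
rewrite mulrDr mulr1 EFinD; apply: leeD.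
  apply: (@le_trans _ _ (\int[mu]_(t in `[0%R, B[) (cst 1 t))%E).
    apply: ge0_le_integral => //.
    - exact: mccdf.
    - by move=> t _; apply: probability_le1.
  by rewrite integral_cst//= lebesgue_measure_itv/= lte_fin B0 mul1e sube0.
rewrite -integral_powR_tail//; apply: ge0_le_integral => //.
- exact: mccdf.
- apply/measurable_EFinP; apply: measurable_funTS.
  by apply: measurable_funM => //; exact: measurable_powR.
- move=> t; rewrite /= in_itv/= andbT => Bt.
  apply: le_trans (tail t (lt_le_trans B0 Bt)).
  rewrite /ccdf /distribution /pushforward le_eqVlt; apply/orP; left; apply/eqP.
  by congr (P _); apply/seteqP; split => w /=; rewrite in_itv/= andbT.
Qed.
End power_tail.

(** * Chunk noises and their medoid *)

Section chunk_noises.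
Context {disp : measure_display} {Omega : measurableType disp} {R : realType}.
Variable P : probability Omega R.
Context {d M r K : nat}.
Variable c : 'I_M * 'I_r -> 'I_K.
Variable nu : 'I_K -> {RV P >-> 'rV[R]_d}.
Hypothesis c_inj : injective c.

Let chunk_points (j : 'I_M) : seq 'I_K := [seq c (j, k) | k <- enum 'I_r].

Let chunk_points_uniq j : uniq (chunk_points j).
Proof. by rewrite map_inj_uniq ?enum_uniq// => k k' /c_inj[]. Qed.

Let chunk_noiseE j w :
  chunk_noise c nu j w = r%:R^-1 *: \sum_(i <- chunk_points j) nu i w.
Proof. by rewrite /chunk_noise big_map big_enum. Qed.

Lemma measurable_chunk_noise j : measurable_fun setT (chunk_noise c nu j).
Proof.
apply: measurable_rVZ; apply: measurable_rV_sum => k _.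
exact: measurable_funPT.
Qed.

Lemma measurable_enorm_chunk j :
  measurable_fun setT (fun w => enorm (chunk_noise c nu j w)).
Proof.
exact: measurableT_comp measurable_enorm (measurable_chunk_noise j).
Qed.

(** The [r] points of a chunk contribute [r sigma^p] to the moment of the sum,
    and the averaging factor contributes [r^(-p)]. *)
Lemma chunk_noise_moment (p sigma : R) j : 1 < p < 2 -> 0 < sigma -> (0 < r)%N ->
  gradient_noise p sigma nu ->
  (\int[P]_w (enorm (chunk_noise c nu j w) `^ p)%R%:E <=
   ((sigma / r%:R `^ ((p - 1) / p)) `^ p)%:E)%E.
Proof.
move=> /andP[p1 p2] sigma0 r0 [nu_indep _ _ nu_sym nu_moment].
have p0 : 0 < p by rewrite (lt_trans _ p1).
have r0' : 0 < r%:R :> R by rewrite ltr0n.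
have scaled w : (enorm (chunk_noise c nu j w) `^ p)%:E =
    ((r%:R^-1 `^ p)%:E * (enorm (\sum_(i <- chunk_points j) nu i w)%R `^ p)%R%:E)%E.
  by rewrite chunk_noiseE enormZ powRM ?enorm_ge0// ger0_norm ?invr_ge0// EFinM.
under eq_integral do rewrite scaled.
rewrite ge0_integralZl_EFin//; last 2 first.
- by move=> w _; rewrite lee_fin powR_ge0.
- apply: measurable_enorm_powR; apply: measurable_rV_sum => i _.
  exact: measurable_funPT.
have -> : (sigma / r%:R `^ ((p - 1) / p)) `^ p =
    r%:R^-1 `^ p * (r%:R * sigma `^ p).
  rewrite powRM ?invr_ge0 ?powR_ge0 ?(ltW sigma0)//.
  rewrite mulrA (mulrC (sigma `^ p)); congr (_ * _).
  rewrite -(powR_inv1 (ltW r0')) -powRN -!powRrM mulN1r.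
  have <- : r%:R `^ (- p + 1) = r%:R `^ (- p) * r%:R :> R.
    by rewrite powRD ?powRr1 ?(ltW r0')// (gt_eqF r0') implybT.
  by congr (_ `^ _); field; rewrite gt_eqF.
rewrite EFinM; apply: lee_wpmul2l; first by rewrite lee_fin powR_ge0.
have p02 : 0 < p <= 2 by rewrite p0 ltW.
apply: (le_trans (moment_sum_symmetric p02 nu_indep nu_sym (chunk_points_uniq j))).
have moment i : (\int[P]_w (enorm (nu i w) `^ p)%R%:E <= (sigma `^ p)%:E)%E.
  by have := nu_moment i; rewrite unlock.
apply: (@le_trans _ _ (\sum_(i <- chunk_points j) (sigma `^ p)%:E)%E).
  exact: lee_sum.
rewrite sumEFin big_const_seq count_predT size_map size_enum_ord iter_addr_0.
by rewrite lee_fin mulr_natl.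
Qed.

Lemma chunk_noise_tail (p m lam : R) j : 0 < p -> 0 < lam -> 0 < m ->
  (\int[P]_w (enorm (chunk_noise c nu j w) `^ p)%R%:E <= (m `^ p)%:E)%E ->
  (P [set w | lam < enorm (chunk_noise c nu j w)]%R <= ((m / lam) `^ p)%:E)%E.
Proof.
move=> p0 lam0 m0 moment.
pose X : {RV P >-> R} := HB.pack (fun w => enorm (chunk_noise c nu j w))
  (isMeasurableFun.Build _ _ _ _ _ (measurable_enorm_chunk j)).
have lamp0 : 0 < lam `^ p by rewrite powR_gt0.
have := @markov _ _ _ P X (@powR R ^~ p) lam lam0 (measurable_powR p).
move=> /(_ (fun r _ => powR_ge0 r p) (ge0_ler_powR (ltW p0))) markov_ineq.
rewrite powRM ?invr_ge0 ?(ltW lam0) ?(ltW m0)// mulrC.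
rewrite -powR_inv1 ?(ltW lam0)// powRAC powR_inv1 ?powR_ge0// EFinM.
rewrite lee_pdivlMl//; apply: le_trans moment.
apply: (@le_trans _ _ ((lam `^ p)%:E * P [set x | lam%:E <= `|(X x)%:E| ])%E).
  rewrite lee_wpmul2l ?lee_fin ?(ltW lamp0)// le_measure ?inE//.
  - rewrite -[X in measurable X]setTI; apply: measurable_fun_ltr => //.
    exact: measurable_enorm_chunk.
  - rewrite -[X in measurable X]setTI; apply: emeasurable_fun_le => //.
    apply: measurableT_comp => //.
    by apply/measurable_EFinP; exact: measurable_enorm_chunk.
  - move=> w /= lamw; rewrite lee_fin ger0_norm ?enorm_ge0//; exact: ltW.
rewrite (le_trans markov_ineq)// unlock le_eqVlt; apply/orP; left; apply/eqP.
by apply: eq_integral => w _ /=; rewrite ger0_norm ?enorm_ge0.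
Qed.

(** Distinct chunks use disjoint blocks of points since [c] is injective. *)
Lemma chunk_tail_independent (lam q : R) (S : {set 'I_M}) :
  mutually_independent nu ->
  (forall j, P [set w | lam < enorm (chunk_noise c nu j w)]%R <= q%:E)%E ->
  (P (\bigcap_(j in [set` S]) [set w | (lam < enorm (chunk_noise c nu j w))%R])
   <= (q ^+ #|S|)%:E)%E.
Proof.
move=> nu_indep tail.
pose tail_event j := [set w | lam < enorm (chunk_noise c nu j w)].
have mtail j : measurable (tail_event j).
  rewrite -[X in measurable X]setTI; apply: measurable_fun_ltr => //.
  exact: measurable_enorm_chunk.
rewrite (@disjoint_blocks_independent _ _ _ P d _ nu nu_indep _
  (fun j => [set i in chunk_points j]%SET) tail_event S).
- have PE j : P (tail_event j) = (fine (P (tail_event j)))%:E.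
    by rewrite fineK// fin_num_measure.
  under eq_bigr do rewrite PE.
  rewrite prodEFin lee_fin -prodr_const; apply: ler_prod => j _.
  by rewrite fine_ge0 ?measure_ge0//= -lee_fin -PE tail.
- move=> j k jk; rewrite disjoint_subset; apply/fintype.subsetP => i.
  rewrite !inE => /mapP[k1 _ ->]; apply/mapP => -[k2 _ /c_inj[jk' _]].
  by rewrite jk' eqxx in jk.
- move=> j.
  rewrite (_ : tail_event j = (fun w => \sum_(i <- chunk_points j) nu i w) @^-1`
      [set v | lam < enorm (r%:R^-1 *: v)]); last first.
    by apply/seteqP; split => w /=; rewrite /tail_event/= chunk_noiseE.
  apply: block_sigma_sum; first by move=> i; rewrite inE.
  rewrite -[X in measurable X]setTI; apply: measurable_fun_ltr => //.
  by apply: measurableT_comp measurable_enorm _; exact: measurable_rVZ.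
Qed.

End chunk_noises.

Section medoid_measurability.
Context {disp : measure_display} {Omega : measurableType disp} {R : realType}.
Context {d M : nat}.

Lemma medoid_index_unique (v : 'I_M -> 'rV[R]_d) j k :
  is_medoid_index v j -> is_medoid_index v k -> j = k.
Proof.
move=> [jmin jfirst] [kmin kfirst]; apply: val_inj => /=.
case: (ltngtP j k) => // [/kfirst|/jfirst]; first by rewrite ltNge jmin.
by rewrite ltNge kmin.
Qed.

Variables (v : 'I_M -> Omega -> 'rV[R]_d) (jstar : Omega -> 'I_M).
Hypothesis mv : forall j, measurable_fun setT (v j).
Hypothesis jstarP : forall w, is_medoid_index (fun j => v j w) (jstar w).

(** The tie-breaking rule determines the medoid index, so its level sets are
    finite intersections of comparisons between measurable costs. *)
Lemma measurable_medoid_index j : measurable (jstar @^-1` [set j]).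
Proof.
have mcost i : measurable_fun setT (fun w => medoid_cost (fun k => v k w) i).
  apply: measurable_sum => k; apply: measurableT_comp measurable_enorm _.
  under eq_fun do rewrite -scaleN1r.
  by apply: measurable_rVD => //; exact: measurable_rVZ.
rewrite (_ : jstar @^-1` [set j] =
  \bigcap_(i in [set: 'I_M]) [set w | medoid_cost (fun k => v k w) j <=
     medoid_cost (fun k => v k w) i] `&`
  \bigcap_(i in [set i : 'I_M | (i < j)%N])
    [set w | medoid_cost (fun k => v k w) j < medoid_cost (fun k => v k w) i]).
  apply: measurableI; apply: fin_bigcap_measurable => // i _.
  - by rewrite -[X in measurable X]setTI; exact: measurable_fun_ler.
  - by rewrite -[X in measurable X]setTI; exact: measurable_fun_ltr.
apply/seteqP; split => w /=.
  by move=> <-; have [jmin jfirst] := jstarP w; split => i /= ?; [exact: jmin|exact: jfirst].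
by move=> [jmin jfirst]; apply: medoid_index_unique (jstarP w) _; split => i;
  [exact: jmin|exact: jfirst].
Qed.

Lemma measurable_medoid : measurable_fun setT (fun w => enorm (v (jstar w) w)).
Proof.
rewrite (_ : (fun w => _) =
  fun w => \sum_(j < M) \1_(jstar @^-1` [set j]) w * enorm (v j w)).
  apply: measurable_sum => j; apply: measurable_funM.
    by apply: measurable_indic; exact: measurable_medoid_index.
  exact: measurableT_comp measurable_enorm (mv j).
apply/funext => w; rewrite (bigD1 (jstar w))//= indicE mem_set// mul1r.
rewrite big1 ?addr0// => j jstar_neq.
by rewrite indicE memNset ?mul0r//= => jstarE; rewrite jstarE eqxx in jstar_neq.
Qed.

End medoid_measurability.

(** * Comparison of the constants *)

(** At level [lam = sqrt t / C] and with [y = m C], the Chernoff bound is a pure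
    power of [t]; both sides have the same logarithm. *)
Lemma chernoff_powR (R : realType) (y h t p gamma : R) (M : nat) :
  0 < y -> 0 < h -> 0 < t -> 0 < p * gamma ->
  (((y / Num.sqrt t) `^ p) `^ gamma / h) ^+ M =
  ((y * h `^ (- (1 / (p * gamma)))) ^+ 2) `^ (p * gamma * M%:R / 2) *
    t `^ (- (p * gamma * M%:R / 2)).
Proof.
move=> y0 h0 t0 pg0.
have pg_neq0 : p * gamma != 0 by rewrite gt_eqF.
have root0 : 0 < Num.sqrt t by rewrite sqrtr_gt0.
apply: ln_inj; rewrite ?posrE.
- by rewrite exprn_gt0// divr_gt0// !powR_gt0// divr_gt0.
- by rewrite mulr_gt0 ?powR_gt0// exprn_gt0// mulr_gt0// powR_gt0.
rewrite -(powR12_sqrt (ltW t0)) lnXn ?divr_gt0 ?powR_gt0 ?divr_gt0//.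
rewrite ln_div ?posrE ?powR_gt0 ?divr_gt0 ?powR_gt0//.
rewrite !ln_powR ln_div ?posrE ?powR_gt0// ln_powR.
rewrite lnM ?posrE ?powR_gt0 ?exprn_gt0 ?mulr_gt0 ?powR_gt0//.
rewrite !ln_powR lnXn ?mulr_gt0 ?powR_gt0// lnM ?posrE ?powR_gt0// ln_powR.
rewrite -[_ *+ M]mulr_natr mulr2n; field.
  by move: pg_neq0; rewrite mulf_eq0 negb_or => /andP[-> ->].
by rewrite powR_gt0.
Qed.

(** The base [h = (1 - gamma)^(1 - gamma) gamma^gamma] is at most [1], so
    dividing by the larger power [1 / ((1 - theta) p gamma)] of it enlarges the
    first factor; the second one grows as [p gamma M] decreases to
    [p theta gamma M > 2]. *)
Lemma medoid_constant_le (R : realType) (p sigma gamma theta rho : R) (M : nat) :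
  0 < p -> 0 < sigma -> 0 < rho -> 0 < gamma < 1 / 2 -> 0 < theta < 1 ->
  2 / (p * theta * gamma) < M%:R ->
  (sigma / rho * ((3 - 2 * gamma) / (1 - 2 * gamma)) *
     ((1 - gamma) `^ (1 - gamma) * gamma `^ gamma) `^ (- (1 / (p * gamma)))) ^+ 2 *
    (1 + (p * gamma * M%:R / 2 - 1)^-1) <=
  ((sigma * ((3 - 2 * gamma) * M%:R + 3) / (rho * ((1 - 2 * gamma) * M%:R) *
    ((1 - gamma) `^ (1 - gamma) * gamma `^ gamma) `^ (1 / ((1 - theta) * p * gamma))))) ^+ 2 *
    (1 + 2 / (p * theta * gamma * M%:R - 2)).
Proof.
move=> p0 sigma0 rho0 /andP[gamma0 gamma_half] /andP[theta0 theta1] M_large.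
set h := (1 - gamma) `^ (1 - gamma) * gamma `^ gamma.
have gamma1 : 0 < 1 - gamma by lra.
have gamma2 : 0 < 1 - 2 * gamma by lra.
have ptg0 : 0 < p * theta * gamma by rewrite !mulr_gt0.
have M0 : 0 < M%:R :> R by rewrite (lt_trans _ M_large)// divr_gt0.
have ptgM : 2 < p * theta * gamma * M%:R by rewrite -ltr_pdivrMl// mulrC.
have pgM : p * theta * gamma * M%:R <= p * gamma * M%:R.
  rewrite ler_pM2r// -mulrA ler_pM2l// ler_piMl//; exact: ltW.
have h0 : 0 < h by rewrite mulr_gt0// powR_gt0.
have powR_le1 (a x : R) : 0 < a <= 1 -> 0 <= x -> a `^ x <= 1.
  by move=> a01 x0; rewrite -(powRr0 a) ger_powR.
have h1 : h <= 1.
  by rewrite mulr_ile1 ?powR_ge0// powR_le1//; lra.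
apply: ler_pM.
- exact: sqr_ge0.
- by rewrite addr_ge0// invr_ge0; lra.
- apply: lerXn2r; rewrite ?nnegrE.
  + by rewrite !mulr_ge0 ?powR_ge0 ?invr_ge0 ?ltW//; lra.
  + rewrite divr_ge0 ?mulr_ge0 ?powR_ge0 ?(ltW gamma2) ?ltW//.
    by rewrite addr_gt0// mulr_gt0//; lra.
  + have -> : sigma * ((3 - 2 * gamma) * M%:R + 3) /
        (rho * ((1 - 2 * gamma) * M%:R) * h `^ (1 / ((1 - theta) * p * gamma))) =
        sigma / rho * (((3 - 2 * gamma) * M%:R + 3) / ((1 - 2 * gamma) * M%:R)) *
        h `^ (- (1 / ((1 - theta) * p * gamma))).
      by rewrite powRN !invfM; ring.
    apply: ler_pM; rewrite ?powR_ge0//.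
    * by rewrite !mulr_ge0 ?invr_ge0 ?ltW//; lra.
    * rewrite ler_pM2l ?divr_gt0// ler_pdivlMr ?mulr_gt0//.
      by rewrite mulrA divfK ?gt_eqF// lerDl.
    * apply: ger_powR; first by rewrite h0.
      rewrite lerN2 !div1r lef_pV2 ?posrE ?mulr_gt0 ?subr_gt0//.
      by rewrite ler_pM2r// ler_piMl ?(ltW p0)//; lra.
- rewrite lerD2l; have -> : (p * gamma * M%:R / 2 - 1)^-1 = 2 / (p * gamma * M%:R - 2).
    by field; rewrite !gt_eqF//; lra.
  by rewrite ler_pM2l// lef_pV2 ?posrE; lra.
Qed.

(** * Second moment of the medoid *)

Theorem theorem2 (disp : measure_display) (Omega : measurableType disp)
    (R : realType) (P : probability Omega R) (d : nat)
    (p sigma gamma theta : R) (M r : nat)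
    (hp : 1 < p < 2) (hsigma : 0 < sigma) (hr : (1 <= r)%N)
    (hgamma : 0 < gamma < 1 / 2) (htheta : 0 < theta < 1)
    (hM0 : (0 < M)%N) (hM : 2 / (p * theta * gamma) < M%:R)
    (nu : 'I_(M * r) -> {RV P >-> 'rV[R]_d})
    (hnu : gradient_noise p sigma nu)
    (c : 'I_M * 'I_r -> 'I_(M * r)) (hc : bijective c)
    (jstar : Omega -> 'I_M)
    (hjstar : forall w,
       is_medoid_index (fun j => chunk_noise c nu j w) (jstar w)) :
  ('E_P[fun w => (enorm (chunk_noise c nu (jstar w) w) ^+ 2)%R] <=
   ((sigma * ((3 - 2 * gamma) * M%:R + 3) /
     (r%:R `^ ((p - 1) / p) * ((1 - 2 * gamma) * M%:R) *
      (((1 - gamma) `^ (1 - gamma) * gamma `^ gamma)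
         `^ (1 / ((1 - theta) * p * gamma))))) ^+ 2 *
    (1 + 2 / (p * theta * gamma * M%:R - 2)))%:E)%E.
Proof.
have [p1 p2] := andP hp; have [gamma0 gamma_half] := andP hgamma.
have [theta0 theta1] := andP htheta.
have c_inj := bij_inj hc.
have p0 : 0 < p by rewrite (lt_trans _ p1).
have pg0 : 0 < p * gamma by rewrite mulr_gt0.
have rho0 : 0 < r%:R `^ ((p - 1) / p) :> R by rewrite powR_gt0// ltr0n.
have gamma1 : 0 < 1 - gamma by lra.
have gamma2 : 0 < 1 - 2 * gamma by lra.
have gamma01 : 0 < gamma < 1 by rewrite gamma0; lra.
have h0 : 0 < (1 - gamma) `^ (1 - gamma) * gamma `^ gamma.
  by rewrite mulr_gt0// powR_gt0.
pose m := sigma / r%:R `^ ((p - 1) / p).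
have m0 : 0 < m by rewrite divr_gt0.
pose C := (3 - 2 * gamma) / (1 - 2 * gamma).
have C0 : 0 < C by rewrite divr_gt0//; lra.
pose v j w := chunk_noise c nu j w.
have mv j : measurable_fun setT (v j) := measurable_chunk_noise c nu j.
have mZ := measurable_medoid mv hjstar.
have mZ2 : measurable_fun setT (fun w => enorm (v (jstar w) w) ^+ 2).
  exact: measurable_funX.
pose Z2 : {RV P >-> R} := HB.pack (fun w => enorm (v (jstar w) w) ^+ 2)
  (isMeasurableFun.Build _ _ _ _ _ mZ2).
apply: (@le_trans _ _ ('E_P[Z2])%E); first by [].
have b1 : 1 < p * gamma * M%:R / 2.
  have pt : p * theta * gamma <= p * gamma.
    by rewrite mulrAC ler_piMr// ltW.
  have : 2 < p * theta * gamma * M%:R.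
    by rewrite mulrC -ltr_pdivrMr// !mulr_gt0.
  have : p * theta * gamma * M%:R <= p * gamma * M%:R by rewrite ler_wpM2r.
  lra.
have const_le := medoid_constant_le p0 hsigma rho0 hgamma htheta hM.
rewrite -lee_fin in const_le; apply: le_trans const_le.
apply: expectation_le_power_tail => //.
- by apply/exprn_gt0/(mulr_gt0 (mulr_gt0 m0 C0)); exact: powR_gt0.
- by move=> w; exact: sqr_ge0.
move=> t t0; rewrite -(chernoff_powR M (mulr_gt0 m0 C0) h0 t0 pg0).
have root0 : 0 < Num.sqrt t by rewrite sqrtr_gt0.
pose lam := Num.sqrt t / C.
have lam0 : 0 < lam by rewrite divr_gt0.
have -> : m * C / Num.sqrt t = m / lam.
  by rewrite (invf_div (Num.sqrt t) C) [RHS]mulrA.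
have q0 : 0 < (m / lam) `^ p by apply/powR_gt0/divr_gt0.
have r_gt0 : (0 < r)%N by [].
pose bad j := [set w | lam < enorm (v j w)].
have tail j : (P (bad j) <= ((m / lam) `^ p)%:E)%E.
  by apply: chunk_noise_tail => //; exact: chunk_noise_moment.
have [nu_indep _ _ _ _] := hnu.
have mbad j : measurable (bad j).
  rewrite -[X in measurable X]setTI; apply: measurable_fun_ltr => //.
  exact: measurable_enorm_chunk.
have := count_tail gamma01 q0 mbad
  (fun S => chunk_tail_independent c_inj S nu_indep tail).
rewrite card_ord; apply: le_trans.
apply: le_measure; rewrite ?inE.
- by rewrite -[X in measurable X]setTI; exact: measurable_fun_ltr.
- rewrite -[X in measurable X]setTI; apply: measurable_fun_ltr => //.
  exact: measurable_count.
move=> w /=; rewrite !ltNge; apply: contraNN => bad_le.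
rewrite -(sqr_sqrtr (ltW t0)); apply: lerXn2r; rewrite ?nnegrE ?enorm_ge0 ?sqrtr_ge0//.
have -> : Num.sqrt t = C * lam by rewrite /lam mulrC divfK// gt_eqF.
apply: (medoid_norm_le (v := v^~ w) (gamma := gamma) (lam := lam) _ _ hgamma).
- by have [] := hjstar w.
- exact: ltW.
rewrite (le_trans _ bad_le)// ler_nat subset_leq_card//.
apply/fintype.subsetP => j; rewrite finset.inE => lamj; rewrite finset.inE.
by apply/mem_set.
Qed.
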